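(* Let $G$ be a finite group and $k$ a field with $\mathrm{char}(k)\nmid|G|$. Let $e$ and $e'$ be subcentral idempotents in $kG$, let $K$ (resp. $K'$) be the subgroup of $G$ generated by the elements of $G$ having nonzero coefficient in $e$ (resp. in $e'$), and let $W$ be a right $k(G/K)$-comodule and $W'$ a right $k(G/K')$-comodule such that the right partial $kG$-comodules $$M=W\,\square^{k(G/K)}\,kGe,\qquad M'=W'\,\square^{k(G/K')}\,kGe'$$ are simple. Then $M$ and $M'$ are isomorphic as partial $kG$-comodules if and only if $K=K'$, $W\cong W'$ (as comodules) and there exists a multiplicative character $\nu$ of $K$ (a group homomorphism $\nu:K\to k^\times$) such that the algebra automorphism $$\Phi: kK\to kK,\qquad g\mapsto\nu(g)g$$ maps $e$ to $e'$.
   Context: Let $H$ be a Hopf algebra over a field $k$ with $\Delta(h)=h_{(1)}\otimes h_{(2)}$, counit $\epsilon$ and antipode $S$; here $H=kG$ is the group algebra with every $g\in G$ grouplike. A right (algebraic) partial $H$-comodule is a $k$-vector space $M$ with a linear map $\rho:M\to M\otimes H$, $\rho(m)=m^{(0)}\otimes m^{(1)}$, such that for all $m\in M$: (1) $m^{(0)}\epsilon(m^{(1)})=m$; (2) $m^{(0)(0)}\otimes {m^{(0)(1)}}_{(1)}\otimes {m^{(0)(1)}}_{(2)}S(m^{(1)}) = m^{(0)(0)(0)}\otimes m^{(0)(0)(1)}\otimes m^{(0)(1)}S(m^{(1)})$; (3) $m^{(0)(0)}\otimes m^{(0)(1)}S({m^{(1)}}_{(1)})\otimes {m^{(1)}}_{(2)}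 = m^{(0)(0)(0)}\otimes m^{(0)(0)(1)}S(m^{(0)(1)})\otimes m^{(1)}$. A morphism $(M,\rho)\to(N,\sigma)$ is a linear map $f$ with $(f\otimes H)\rho=\sigma f$. A partial subcomodule is a subspace $N$ with $\rho(N)\subseteq N\otimes H$; $M$ is simple if $M\neq0$ and its only partial subcomodules are $0$ and $M$. A subcentral idempotent of $H$ is a nonzero idempotent $e\in H$ with $ee_{(1)}\otimes e_{(2)}=e_{(1)}e\otimes e_{(2)}$. For $H=kG$, the smallest right coideal subalgebra (subalgebra $A$ with $\Delta(A)\subseteq A\otimes H$) containing $e$ is $kK$ with $K$ as in the claim, and $e$ is central in $kK$. The coalgebra $k(G/K)$ has as basis of grouplikes the set $G/K$ of left cosets; it is the quotient $kG/(kG\,(kK)^+)$, where $(kK)^+=kK\cap\ker\epsilon$, with projection $\pi:kG\to k(G/K)$, $g\mapsto gK$. The left ideal $kGe$ is a left $k(G/K)$-comodule by restriction of $(\pi\otimes kG)\Delta$. For a right $k(G/K)$-comodule $W$ (coaction $w\mapsto w^{(0)}\otimes w^{(1)}$), the cotensor product is $$W\,\square^{k(G/K)}kGe=\Big\{\textstyle\sum_i w_i\otimes x_i\in W\otimes kGe \;:\; \sum_i w_i^{(0)}\otimes w_i^{(1)}\otimes x_i=\sum_i w_i\otimes\pi({x_i}_{(1)})\otimes {x_i}_{(2)}\Big\},$$ which is a right partial $kG$-comodule via $\sum_i w_i\otimes x_i\mapsto\sum_i w_i\otimes {x_i}_{(1)}e\otimes {x_i}_{(2)}$. The same applies to $e',K',W'$.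 *)

(* Defs.v *)
From HB Require Import structures.
From mathcomp Require Import all_boot all_order all_algebra all_fingroup.
From mathcomp Require Import pgroup.
From mathcomp Require Import boolp.

Set Implicit Arguments.
Unset Strict Implicit.
Unset Printing Implicit Defensive.

Import GRing.Theory.
Local Open Scope ring_scope.

(* All coalgebras below are spanned by a finite set of grouplike elements.
   With [B] the finite set of grouplikes, [kspan k B] is the vector space with
   basis [B], and [V (x) kB] is represented, in this basis, by the functions
   [B -> V]: [t] stands for the sum over [b] of [t b (x) b].  Iterated tensor
   products associate to the left: [(V (x) kB) (x) kC = {ffun C -> {ffun B -> V}}].
   Beware that the ring structure of the library on {ffun _ -> k} is pointwise;
   the product of the group algebra is [gmul] below. *)
Notation kspan k B := {ffun B -> k^o}.
Notation tens V B := {ffun B -> V}.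

Section Tensor.
Variables (k : fieldType) (B : finType).

Definition bas (b : B) : kspan k B := [ffun c => (b == c)%:R].

Definition tensor (V : lmodType k) (v : V) (x : kspan k B) : tens V B :=
  [ffun b => x b *: v].

(* Sweedler notation: if [t = t0 (x) t1] then [sweedler t F = F t0 t1].  This is
   the linear map induced by [F] whenever [F] is bilinear. *)
Definition sweedler (V U : lmodType k) (t : tens V B)
    (F : V -> kspan k B -> U) : U := \sum_b F (t b) (bas b).

End Tensor.

Notation "v ⊗ x" := (tensor v x) (at level 40, left associativity).

Section Coalgebra.
Variables (k : fieldType) (B : finType).

Definition comul (x : kspan k B) : tens (kspan k B) B :=
  \sum_b x b *: (bas k b ⊗ bas k b).

Definition counit (x : kspan k B) : k := \sum_b x b.

(* Right comodules over the coalgebra [kB]. *)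
Record comodule := Comodule {
  comod_space : lmodType k;
  comod_coact : {linear comod_space -> tens comod_space B};
  comod_counit : forall w,
    sweedler (comod_coact w) (fun w0 w1 => counit w1 *: w0) = w;
  comod_coassoc : forall w,
    sweedler (comod_coact w) (fun w0 w1 =>
      sweedler (comod_coact w0) (fun w00 w01 => w00 ⊗ w01 ⊗ w1))
    = sweedler (comod_coact w) (fun w0 w1 =>
      sweedler (comul w1) (fun a b => w0 ⊗ a ⊗ b)) }.

Definition comod_isomorphic (W W' : comodule) : Prop :=
  exists2 f : {linear comod_space W -> comod_space W'},
    bijective f &
    forall w, sweedler (comod_coact W w) (fun w0 w1 => f w0 ⊗ w1)
              = comod_coact W' (f w).

End Coalgebra.

Section GroupAlgebra.
Variables (k : fieldType) (G : finGroupType).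
Implicit Types x y : kspan k G.

Definition gmul x y : kspan k G :=
  \sum_g \sum_h (x g * y h) *: bas k (g * h)%g.

Definition gantipode x : kspan k G := \sum_g x g *: bas k (g^-1)%g.

(* [kG] carries the Hopf algebra structure [gmul], [comul], [counit] and
   [gantipode]; these are its right algebraic partial comodules. *)
Record pcomodule := PComodule {
  pcom_space : lmodType k;
  pcom_coact : {linear pcom_space -> tens pcom_space G};
  pcom_counit : forall m,
    sweedler (pcom_coact m) (fun m0 m1 => counit m1 *: m0) = m;
  pcom_coassocl : forall m,
    sweedler (pcom_coact m) (fun m0 m1 =>
      sweedler (pcom_coact m0) (fun m00 m01 =>
        sweedler (comul m01) (fun a b => m00 ⊗ a ⊗ gmul b (gantipode m1))))
    = sweedler (pcom_coact m) (fun m0 m1 =>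
      sweedler (pcom_coact m0) (fun m00 m01 =>
        sweedler (pcom_coact m00) (fun m000 m001 =>
          m000 ⊗ m001 ⊗ gmul m01 (gantipode m1))));
  pcom_coassocr : forall m,
    sweedler (pcom_coact m) (fun m0 m1 =>
      sweedler (pcom_coact m0) (fun m00 m01 =>
        sweedler (comul m1) (fun a b => m00 ⊗ gmul m01 (gantipode a) ⊗ b)))
    = sweedler (pcom_coact m) (fun m0 m1 =>
      sweedler (pcom_coact m0) (fun m00 m01 =>
        sweedler (pcom_coact m00) (fun m000 m001 =>
          m000 ⊗ gmul m001 (gantipode m01) ⊗ m1))) }.

Definition pcom_morphism (M N : pcomodule)
    (f : {linear pcom_space M -> pcom_space N}) : Prop :=
  forall m, sweedler (pcom_coact M m) (fun m0 m1 => f m0 ⊗ m1)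
            = pcom_coact N (f m).

Definition pcom_isomorphic (M N : pcomodule) : Prop :=
  exists2 f : {linear pcom_space M -> pcom_space N},
    bijective f & pcom_morphism f.

(* In coordinates, [N (x) kG] is the set of functions with values in [N]. *)
Definition psubcomodule (M : pcomodule) (N : {pred pcom_space M}) : Prop :=
  submod_closed N /\
  (forall m, m \in N -> forall g, pcom_coact M m g \in N).

Definition pcom_simple (M : pcomodule) : Prop :=
  (exists m : pcom_space M, m != 0) /\
  (forall N : {pred pcom_space M}, psubcomodule N ->
     N =i pred1 0 \/ N =i predT).

Record subcentral := Subcentral {
  sc_val :> kspan k G;
  sc_neq0 : sc_val != 0;
  sc_idem : gmul sc_val sc_val = sc_val;
  (* e e_(1) (x) e_(2) = e_(1) e (x) e_(2) *)
  sc_comul : sweedler (comul sc_val) (fun e1 e2 => gmul sc_val e1 ⊗ e2)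
      = sweedler (comul sc_val) (fun e1 e2 => gmul e1 sc_val ⊗ e2) }.

Definition supp_group x : {group G} := <<[set g | x g != 0]>>%G.

Definition left_ideal (e x : kspan k G) : Prop := exists y, x = gmul y e.

(* Only the restriction of [nu] to [K] matters here and in [char_twist]. *)
Definition mult_character (K : {group G}) (nu : G -> k) : Prop :=
  {in K, forall g, nu g \is a GRing.unit} /\
  {in K &, {morph nu : g h / (g * h)%g >-> g * h}}.

Definition char_twist (K : {group G}) (nu : G -> k) x : kspan k G :=
  \sum_(g in K) (x g * nu g) *: bas k g.

End GroupAlgebra.

(* The set of left cosets, i.e. the grouplike basis of [k(G/K)]. *)
Definition cosets (G : finGroupType) (K : {group G}) : finType :=
  {C : {set G} | C \in lcosets K [set: G]}.

Lemma lcoset_in (G : finGroupType) (K : {group G}) (g : G) :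
  (g *: K)%g \in lcosets K [set: G].
Proof. by apply/lcosetsP; exists g; rewrite ?inE. Qed.

Definition cast_comodule (k : fieldType) (G : finGroupType) (K K' : {group G})
    (eqK : K = K') (W : comodule k (cosets K)) : comodule k (cosets K') :=
  eq_rect K (fun L : {group G} => comodule k (cosets L)) W K' eqK.

Definition coset_pt (G : finGroupType) (K : {group G}) (g : G) : cosets K :=
  exist _ (g *: K)%g (lcoset_in K g).

Definition coset_proj (k : fieldType) (G : finGroupType) (K : {group G})
    (x : kspan k G) : kspan k (cosets K) := \sum_g x g *: bas k (coset_pt K g).

Section Coordinates.
Variables (k : fieldType).

Lemma tensorE (B : finType) (V : lmodType k) (v : V) (x : kspan k B) b :
  (v ⊗ x) b = x b *: v.
Proof. by rewrite ffunE. Qed.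

Lemma basE (B : finType) (b c : B) : bas k b c = (b == c)%:R.
Proof. by rewrite ffunE. Qed.

Lemma sum_eqZ (B : finType) (V : lmodType k) (F : B -> V) c :
  \sum_b ((b == c)%:R : k) *: F b = F c.
Proof.
rewrite (bigD1 c) //= eqxx scale1r big1 ?addr0 // => b /negbTE nbc.
by rewrite nbc scale0r.
Qed.

Lemma tensorZl (B : finType) (V : lmodType k) a (v : V) (x : kspan k B) :
  (a *: v) ⊗ x = a *: (v ⊗ x).
Proof. by apply/ffunP => b; rewrite !ffunE !scalerA mulrC. Qed.

Lemma tensorZr (B : finType) (V : lmodType k) a (v : V) (x : kspan k B) :
  v ⊗ (a *: x) = a *: (v ⊗ x).
Proof. by apply/ffunP => b; rewrite !ffunE scalerA. Qed.

Lemma tensor2E (B C : finType) (V : lmodType k) (v : V) (b : B) (c : C) q p :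
  (v ⊗ bas k b ⊗ bas k c) q p = ((c == q) && (b == p))%:R *: v.
Proof. by rewrite !ffunE scalerA -natrM mulnb. Qed.

Lemma sum_tensor2 (I B C : finType) (V : lmodType k) (v : I -> V)
    (b : I -> B) (c : I -> C) q p :
  (\sum_i v i ⊗ bas k (b i) ⊗ bas k (c i)) q p
  = \sum_(i | (c i == q) && (b i == p)) v i.
Proof.
rewrite !sum_ffunE [RHS]big_mkcond; apply: eq_bigr => i _.
by rewrite tensor2E; case: ifP; rewrite ?scale1r ?scale0r.
Qed.

Lemma lin_bas (B : finType) (U : lmodType k) (F : B -> U) (b : B) :
  \sum_c bas k b c *: F c = F b.
Proof.
rewrite -[RHS](sum_eqZ F b); apply: eq_bigr => c _.
by rewrite basE eq_sym.
Qed.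

Lemma comulE (B : finType) (x : kspan k B) b : comul x b = x b *: bas k b.
Proof.
rewrite sum_ffunE -[RHS](sum_eqZ (fun b => x b *: bas k b)).
apply: eq_bigr => c _; rewrite !ffunE.
by rewrite !scalerA mulrC.
Qed.

Lemma sweedler_comul (B : finType) (U : lmodType k) (x : kspan k B)
    (F : kspan k B -> kspan k B -> U) :
    (forall a y z, F (a *: y) z = a *: F y z) ->
  sweedler (comul x) F = \sum_b x b *: F (bas k b) (bas k b).
Proof. by move=> FZ; apply: eq_bigr => b _; rewrite comulE FZ. Qed.

Lemma comul_bas (B : finType) (U : lmodType k) (b : B)
    (F : kspan k B -> kspan k B -> U) :
    (forall a y z, F (a *: y) z = a *: F y z) ->
  sweedler (comul (bas k b)) F = F (bas k b) (bas k b).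
Proof. by move=> FZ; rewrite sweedler_comul ?lin_bas. Qed.

Lemma sum_tensor_bas (B : finType) (V : lmodType k) (F : B -> V) :
  \sum_b F b ⊗ bas k b = [ffun b => F b].
Proof.
apply/ffunP => c; rewrite sum_ffunE ffunE -[RHS](sum_eqZ F).
by apply: eq_bigr => b _; rewrite !ffunE.
Qed.

Lemma tensor_suml (I B : finType) (V : lmodType k) (v : I -> V)
    (x : kspan k B) : (\sum_i v i) ⊗ x = \sum_i v i ⊗ x.
Proof.
apply/ffunP => b; rewrite sum_ffunE ffunE scaler_sumr.
by apply: eq_bigr => i _; rewrite ffunE.
Qed.

Lemma tensor_sum (B : finType) (V : lmodType k) (t : tens V B) :
  t = \sum_b t b ⊗ bas k b.
Proof. by rewrite sum_tensor_bas; apply/ffunP => b; rewrite ffunE. Qed.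

Lemma counit_bas (B : finType) (b : B) : counit (bas k b) = 1.
Proof.
rewrite /counit (bigD1 b) //= basE eqxx big1 ?addr0 // => c.
by rewrite eq_sym basE => /negbTE ->.
Qed.

Variables (G : finGroupType).
Implicit Types x y : kspan k G.

Lemma gmulE x y z : gmul x y z = \sum_g x g * y (g^-1 * z)%g.
Proof.
rewrite sum_ffunE; apply: eq_bigr => g _; rewrite sum_ffunE.
rewrite (bigD1 (g^-1 * z)%g) //= !ffunE mulKVg eqxx big1 => [|h nh].
  by rewrite addr0 [_ *: _]mulr1.
rewrite !ffunE; case: eqP => [gh|_]; last by rewrite scaler0.
by rewrite -gh mulKg eqxx in nh.
Qed.

Lemma gmul_basl g y z : gmul (bas k g) y z = y (g^-1 * z)%g.
Proof. by rewrite gmulE; exact: (lin_bas (fun g => y (g^-1 * z)%g : k^o)). Qed.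

Lemma gmul_basr x g z : gmul x (bas k g) z = x (z * g^-1)%g.
Proof.
rewrite gmulE (bigD1 (z * g^-1)%g) //= basE invMg invgK mulgKV eqxx mulr1.
rewrite big1 ?addr0 // => h nh; rewrite basE; case: eqP => [gh|_]; last by rewrite mulr0.
by rewrite gh invMg invgK mulKVg eqxx in nh.
Qed.

Lemma gmul_bas (g h : G) : gmul (bas k g) (bas k h) = bas k (g * h)%g.
Proof.
by apply/ffunP => z; rewrite gmul_basl !basE -(inj_eq (@mulgI G g)) mulKVg.
Qed.

Lemma gantipode_bas (g : G) : gantipode (bas k g) = bas k g^-1%g.
Proof. exact: lin_bas. Qed.

Lemma gmulZl a x y : gmul (a *: x) y = a *: gmul x y.
Proof.
apply/ffunP => z; rewrite ffunE !gmulE scaler_sumr.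
by apply: eq_bigr => g _; rewrite !ffunE /GRing.scale /= mulrA.
Qed.

Lemma gmulZr a x y : gmul x (a *: y) = a *: gmul x y.
Proof.
apply/ffunP => z; rewrite ffunE !gmulE scaler_sumr.
by apply: eq_bigr => g _; rewrite !ffunE /GRing.scale /= mulrCA.
Qed.

Lemma gmulA x y z : gmul x (gmul y z) = gmul (gmul x y) z.
Proof.
apply/ffunP => u; rewrite !gmulE.
under eq_bigr => g _ do rewrite gmulE mulr_sumr.
under [RHS]eq_bigr => g _ do rewrite gmulE mulr_suml.
rewrite [RHS]exchange_big; apply: eq_bigr => g _ /=.
rewrite [RHS](reindex_inj (@mulgI G g)); apply: eq_bigr => h _ /=.
by rewrite mulKg mulrA invMg mulgA.
Qed.

Lemma gantipodeZ a x : gantipode (a *: x) = a *: gantipode x.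
Proof. by rewrite scaler_sumr; apply: eq_bigr => g _; rewrite ffunE scalerA. Qed.

Lemma coset_proj_bas (K : {group G}) g :
  coset_proj K (bas k g) = bas k (coset_pt K g).
Proof. exact: lin_bas. Qed.

Lemma coset_projZ (K : {group G}) a x :
  coset_proj K (a *: x) = a *: coset_proj K x.
Proof. by rewrite scaler_sumr; apply: eq_bigr => g _; rewrite ffunE scalerA. Qed.

Lemma coset_ptP (K : {group G}) g h :
  reflect (coset_pt K g = coset_pt K h) (g^-1 * h \in K)%g.
Proof.
rewrite -mem_lcoset; apply: (iffP idP) => [gh|/(congr1 val) /= ->].
  by apply: val_inj => /=; apply/lcoset_eqP; rewrite // lcoset_sym.
exact: lcoset_refl.
Qed.

Lemma subcentralP (e : subcentral k G) (g h : G) :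
  e g * e h = e g * e (g^-1 * h * g)%g.
Proof.
have := sc_comul e; rewrite !sweedler_comul; first last.
- by move=> a y z; rewrite gmulZr tensorZl.
- by move=> a y z; rewrite gmulZl tensorZl.
under eq_bigr => b _ do rewrite -tensorZl.
under [RHS]eq_bigr => b _ do rewrite -tensorZl.
rewrite !sum_tensor_bas => /ffunP/(_ g)/ffunP/(_ (h * g)%g).
by rewrite !ffunE gmul_basl gmul_basr mulgK mulgA.
Qed.

Lemma supp_groupP (x : kspan k G) g : x g != 0 -> g \in supp_group x.
Proof. by move=> xg; rewrite mem_gen ?inE. Qed.

End Coordinates.

Section Cotensor.
Variables (k : fieldType) (G : finGroupType) (e : subcentral k G).
Variable (W : comodule k (cosets (supp_group e))).
Local Notation K := (supp_group e).
Local Notation WG := (tens (comod_space W) G).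

(* The elements [sum_i w_i (x) x_i] of [W (x) kGe], regarded as elements of
   [W (x) kG], that satisfy the cotensor condition. *)
Definition in_cotensor (t : WG) : Prop :=
  exists (n : nat) (w : 'I_n -> comod_space W) (x : 'I_n -> kspan k G),
  [/\ forall i, left_ideal e (x i),
      t = \sum_i w i ⊗ x i
    & \sum_i sweedler (comod_coact W (w i)) (fun w0 w1 => w0 ⊗ w1 ⊗ x i)
      = \sum_i sweedler (comul (x i))
          (fun x1 x2 => w i ⊗ coset_proj K x1 ⊗ x2)].

Definition cotensor_pred : {pred WG} := [pred t | `[< in_cotensor t >]].

(* [w (x) x |-> w (x) x_(1) e (x) x_(2)], shown below to restrict to the cotensor
   product. *)
Definition cotensor_map (t : WG) : tens WG G :=
  sweedler t (fun w x =>
    sweedler (comul x) (fun x1 x2 => w ⊗ gmul x1 e ⊗ x2)).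

Lemma cotensor_cond n (w : 'I_n -> comod_space W) (x : 'I_n -> kspan k G) :
  (\sum_i sweedler (comod_coact W (w i)) (fun w0 w1 => w0 ⊗ w1 ⊗ x i)
      = \sum_i sweedler (comul (x i))
          (fun x1 x2 => w i ⊗ coset_proj K x1 ⊗ x2)) <->
  (forall g, comod_coact W ((\sum_i w i ⊗ x i) g)
           = (\sum_i w i ⊗ x i) g ⊗ bas k (coset_pt K g)).
Proof.
have L i : sweedler (comod_coact W (w i)) (fun w0 w1 => w0 ⊗ w1 ⊗ x i)
         = comod_coact W (w i) ⊗ x i.
  rewrite [in RHS](tensor_sum (comod_coact W (w i))) /sweedler.
  by rewrite [RHS]tensor_suml.
have R i : sweedler (comul (x i)) (fun x1 x2 => w i ⊗ coset_proj K x1 ⊗ x2)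
         = [ffun g => x i g *: (w i ⊗ bas k (coset_pt K g))].
  rewrite sweedler_comul => [|a y z]; last first.
    by rewrite coset_projZ tensorZr tensorZl.
  rewrite -sum_tensor_bas; apply: eq_bigr => g _.
  by rewrite coset_proj_bas tensorZl.
under eq_bigr => i _ do rewrite L.
under [X in _ = X <-> _]eq_bigr => i _ do rewrite R.
have E g : comod_coact W ((\sum_i w i ⊗ x i) g)
         = (\sum_i comod_coact W (w i) ⊗ x i) g.
  rewrite !sum_ffunE linear_sum; apply: eq_bigr => i _.
  by rewrite !tensorE linearZ.
have F g : (\sum_i w i ⊗ x i) g ⊗ bas k (coset_pt K g)
         = (\sum_i [ffun g => x i g *: (w i ⊗ bas k (coset_pt K g))]) g.
  rewrite !sum_ffunE tensor_suml; apply: eq_bigr => i _.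
  by rewrite tensorE ffunE tensorZl.
split=> [H g|H]; first by rewrite E F H.
by apply/ffunP => g; rewrite -E -F.
Qed.

Lemma in_cotensorP (t : WG) :
  in_cotensor t <->
  (forall g, t g = \sum_h e (h^-1 * g)%g *: t h) /\
  (forall g, comod_coact W (t g) = t g ⊗ bas k (coset_pt K g)).
Proof.
split=> [[n [w [x [xe -> /cotensor_cond wx]]]]|[te tW]].
  split=> // g; rewrite sum_ffunE.
  under [RHS]eq_bigr => h _ do rewrite sum_ffunE scaler_sumr.
  rewrite exchange_big; apply: eq_bigr => i _ /=.
  have {1}-> : x i = gmul (x i) e.
    by case: (xe i) => y ->; rewrite -gmulA sc_idem.
  rewrite tensorE gmulE scaler_suml; apply: eq_bigr => h _.
  by rewrite tensorE scalerA mulrC.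
have tE : t = \sum_(i < #|G|) t (enum_val i) ⊗ gmul (bas k (enum_val i)) e.
  rewrite -(big_enum_val (fun g => t g ⊗ gmul (bas k g) e)) /=.
  apply/ffunP => g; rewrite sum_ffunE te; apply: eq_bigr => h _.
  by rewrite tensorE gmul_basl.
exists #|G|, (fun i => t (enum_val i)), (fun i => gmul (bas k (enum_val i)) e).
split=> //; first by move=> i; exists (bas k (enum_val i)).
by apply/cotensor_cond; rewrite -tE.
Qed.

Lemma cotensorP (t : WG) :
  reflect ((forall g, t g = \sum_h e (h^-1 * g)%g *: t h) /\
           (forall g, comod_coact W (t g) = t g ⊗ bas k (coset_pt K g)))
          (t \in cotensor_pred).
Proof. by apply: (iffP (asboolP _)) => /in_cotensorP. Qed.

Fact cotensor_submod_closed : submod_closed cotensor_pred.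
Proof.
split=> [|a u v /cotensorP[ue uW] /cotensorP[ve vW]]; apply/cotensorP.
  split=> g; rewrite !ffunE ?linear0.
    by rewrite big1 // => h _; rewrite ffunE scaler0.
  by apply/ffunP => c; rewrite !ffunE scaler0.
split=> g; rewrite !ffunE.
  rewrite ue ve scaler_sumr -big_split; apply: eq_bigr => h _ /=.
  by rewrite !ffunE scalerDr !scalerA mulrC.
by rewrite linearP uW vW; apply/ffunP => c; rewrite !ffunE scalerDr !scalerA mulrC.
Qed.

HB.instance Definition _ :=
  GRing.isSubmodClosed.Build k WG cotensor_pred cotensor_submod_closed.

Lemma cotensor_mapE (t : WG) g : cotensor_map t g = t g ⊗ gmul (bas k g) e.
Proof.
have E b : sweedler (comul (bas k b)) (fun x1 x2 => t b ⊗ gmul x1 e ⊗ x2)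
         = t b ⊗ gmul (bas k b) e ⊗ bas k b.
  by rewrite comul_bas // => a y z; rewrite gmulZl tensorZr tensorZl.
rewrite /cotensor_map {1}/sweedler (eq_bigr _ (fun b _ => E b)).
by rewrite sum_tensor_bas ffunE.
Qed.

Lemma cotensor_map_in (t : WG) g :
  t \in cotensor_pred -> cotensor_map t g \in cotensor_pred.
Proof.
move=> /cotensorP[te tW]; apply/cotensorP; rewrite cotensor_mapE.
split=> h; rewrite tensorE.
  have {1}-> : gmul (bas k g) e = gmul (gmul (bas k g) e) e.
    by rewrite -gmulA sc_idem.
  rewrite gmulE scaler_suml; apply: eq_bigr => x _.
  by rewrite tensorE scalerA mulrC.
rewrite linearZ /= tW tensorZl gmul_basl.
have [e0|/supp_groupP/coset_ptP -> //] := eqVneq (e (g^-1 * h)%g) 0.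
set a : k := e _; have -> : a = 0 by exact: e0.
by rewrite [LHS]scale0r [RHS]scale0r.
Qed.

Record cotensor_space :=
  Cotensor { cot_val : WG; cot_valP : cot_val \in cotensor_pred }.

HB.instance Definition _ := [isSub for cot_val].
HB.instance Definition _ := [Choice of cotensor_space by <:].
HB.instance Definition _ := [SubChoice_isSubLmodule of cotensor_space by <:].

Definition cotensor_coact (t : cotensor_space) : tens cotensor_space G :=
  [ffun g => Cotensor (cotensor_map_in g (cot_valP t))].

Lemma cotensor_coactE t g :
  cot_val (cotensor_coact t g) = cot_val t g ⊗ gmul (bas k g) e.
Proof. by rewrite ffunE /= cotensor_mapE. Qed.

Fact cotensor_coact_linear : linear cotensor_coact.
Proof.
move=> a u v; apply/ffunP => g; apply: val_inj.
rewrite /= cotensor_coactE !ffunE /= !cotensor_mapE.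
by apply/ffunP => h; rewrite !ffunE scalerDr !scalerA mulrC.
Qed.

HB.instance Definition _ :=
  GRing.isLinear.Build k cotensor_space (tens cotensor_space G) *:%R
    cotensor_coact cotensor_coact_linear.


Local Notation rho := cotensor_coact.

Lemma val_coact t g x :
  cot_val (rho t g) x = e (g^-1 * x)%g *: cot_val t g.
Proof. by rewrite cotensor_coactE tensorE gmul_basl. Qed.

Lemma cot_val_sum (I : Type) (r : seq I) (P : pred I) (F : I -> cotensor_space) x :
  cot_val (\sum_(i <- r | P i) F i) x = \sum_(i <- r | P i) cot_val (F i) x.
Proof. by elim/big_rec2: _ => [|i u v _ <-]; rewrite ffunE. Qed.

Lemma cotensor_counit t :
  sweedler (rho t) (fun m0 m1 => counit m1 *: m0) = t.
Proof.
apply: val_inj; apply/ffunP => x; rewrite cot_val_sum.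
case/cotensorP: (cot_valP t) => -> _; apply: eq_bigr => g _.
by rewrite counit_bas scale1r val_coact.
Qed.

Lemma cotensor_coassocl t :
  sweedler (rho t) (fun m0 m1 =>
    sweedler (rho m0) (fun m00 m01 =>
      sweedler (comul m01) (fun a b => m00 ⊗ a ⊗ gmul b (gantipode m1))))
  = sweedler (rho t) (fun m0 m1 =>
    sweedler (rho m0) (fun m00 m01 =>
      sweedler (rho m00) (fun m000 m001 =>
        m000 ⊗ m001 ⊗ gmul m01 (gantipode m1)))).
Proof.
transitivity (\sum_(u : G * G) rho (rho t u.1) u.2 ⊗ bas k u.2
                                 ⊗ bas k (u.2 * u.1^-1)%g).
  rewrite [LHS]pair_bigA; apply: eq_bigr => -[g h] _ /=.
  rewrite [LHS]comul_bas => [|a y z]; last by rewrite tensorZr tensorZl.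
  by rewrite gantipode_bas gmul_bas.
transitivity (\sum_(u : G * (G * G)) rho (rho (rho t u.1) u.2.1) u.2.2
                 ⊗ bas k u.2.2 ⊗ bas k (u.2.1 * u.1^-1)%g); last first.
  rewrite -(pair_bigA _ (fun g v => rho (rho (rho t g) v.1) v.2
                 ⊗ bas k v.2 ⊗ bas k (v.1 * g^-1)%g)) /=.
  apply: eq_bigr => g _.
  rewrite -(pair_bigA _ (fun h l => rho (rho (rho t g) h) l
                 ⊗ bas k l ⊗ bas k (h * g^-1)%g)) /=.
  apply: eq_bigr => h _; apply: eq_bigr => l _.
  by rewrite gantipode_bas gmul_bas.
apply/ffunP => q; apply/ffunP => p; rewrite !sum_tensor2.
rewrite (big_pred1 ((q^-1 * p)%g, p)) => [|[g h]] /=; last first.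
  rewrite xpair_eqE andbC [RHS]andbC; case: eqP => //= ->.
  by apply/eqP/eqP => [<-|->]; rewrite invMg invgK ?mulgKV ?mulKVg.
rewrite (reindex_onto (fun g => (g, ((q * g)%g, p))) fst) /=; last first.
  by case=> g [h l] /= /andP[/eqP <- /eqP ->]; rewrite mulgKV.
apply: val_inj; apply/ffunP => x; rewrite [RHS]cot_val_sum.
rewrite (eq_bigl predT) => [|g]; last by rewrite mulgK !eqxx.
case/cotensorP: (cot_valP t) => te _.
rewrite !val_coact te !scaler_sumr; apply: eq_bigr => g _.
rewrite !val_coact !scalerA; congr (_ *: _).
have E : e ((q * g)^-1 * p)%g * e (g^-1 * (q * g))%g
       = e (g^-1 * (q^-1 * p))%g * e ((q^-1 * p)^-1 * p)%g.
  rewrite invMg -mulgA subcentralP; congr (_ * e _).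
  by rewrite !invMg !invgK !mulgA ?(mulgK, mulgKV).
rewrite -[LHS]mulrA [LHS]mulrC -[LHS]mulrA mulrC -[RHS]mulrA.
by rewrite E [RHS]mulrCA -[LHS]mulrA.
Qed.

Lemma cotensor_coassocr t :
  sweedler (rho t) (fun m0 m1 =>
    sweedler (rho m0) (fun m00 m01 =>
      sweedler (comul m1) (fun a b => m00 ⊗ gmul m01 (gantipode a) ⊗ b)))
  = sweedler (rho t) (fun m0 m1 =>
    sweedler (rho m0) (fun m00 m01 =>
      sweedler (rho m00) (fun m000 m001 =>
        m000 ⊗ gmul m001 (gantipode m01) ⊗ m1))).
Proof.
transitivity (\sum_(u : G * G) rho (rho t u.1) u.2
                ⊗ bas k (u.2 * u.1^-1)%g ⊗ bas k u.1).
  rewrite [LHS]pair_bigA; apply: eq_bigr => -[g h] _ /=.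
  rewrite [LHS]comul_bas => [|a y z]; last first.
    by rewrite gantipodeZ gmulZr tensorZr tensorZl.
  by rewrite gantipode_bas gmul_bas.
transitivity (\sum_(u : G * (G * G)) rho (rho (rho t u.1) u.2.1) u.2.2
                 ⊗ bas k (u.2.2 * u.2.1^-1)%g ⊗ bas k u.1); last first.
  rewrite -(pair_bigA _ (fun g v => rho (rho (rho t g) v.1) v.2
                 ⊗ bas k (v.2 * v.1^-1)%g ⊗ bas k g)) /=.
  apply: eq_bigr => g _.
  rewrite -(pair_bigA _ (fun h l => rho (rho (rho t g) h) l
                 ⊗ bas k (l * h^-1)%g ⊗ bas k g)) /=.
  apply: eq_bigr => h _; apply: eq_bigr => l _.
  by rewrite gantipode_bas gmul_bas.
apply/ffunP => q; apply/ffunP => p; rewrite !sum_tensor2.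
rewrite (big_pred1 (q, (p * q)%g)) => [|[g h]] /=; last first.
  rewrite xpair_eqE; case: eqP => //= ->.
  by apply/eqP/eqP => [<-|->]; rewrite ?mulgK ?mulgKV.
rewrite (reindex_onto (fun h => (q, (h, (p * h)%g))) (fun u => u.2.1)) /=; last first.
  by case=> g [h l] /= /andP[/eqP <- /eqP <-]; rewrite mulgKV.
apply: val_inj; apply/ffunP => x; rewrite [RHS]cot_val_sum.
rewrite (eq_bigl predT) => [|g]; last by rewrite mulgK !eqxx.
have ee : e (q^-1 * p^-1 * x)%g
        = \sum_h e (q^-1 * h)%g * e (h^-1 * p^-1 * x)%g.
  rewrite -{1}(sc_idem e) gmulE (reindex_inj (@mulgI G q^-1%g)) /=.
  by apply: eq_bigr => h _; rewrite invMg invgK !mulgA mulgK.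
rewrite !val_coact invMg ee.
rewrite scaler_suml; apply: eq_bigr => h _.
rewrite !val_coact !scalerA invMg; congr (_ *: _).
have E : e (h^-1 * (p * h))%g * e (q^-1 * h)%g
       = e (q^-1 * (p * q))%g * e (q^-1 * h)%g.
  rewrite [RHS]mulrC [RHS]subcentralP [LHS]mulrC; congr (_ * e _).
  by rewrite !invMg !invgK !mulgA !(mulgK, mulgKV).
by rewrite -[RHS]mulrA E [RHS]mulrA [RHS]mulrC [RHS]mulrA.
Qed.

Definition cotensor : pcomodule k G :=
  PComodule (pcom_coact := rho)
    cotensor_counit cotensor_coassocl cotensor_coassocr.

End Cotensor.

(* Main.v *)
(** A comodule [W] over [k(G/K)] is graded by [G/K], and any homogeneous line in
   [W] gives a partial subcomodule of [M]. Simplicity of [M] thus forces [W] to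
   be a line [k w] of some degree [gK], and [M] has spanning vectors
   [b_x = w (x) xe] for [x] in [gK], with coaction
   [b_x |-> sum_y e(x^-1 y) b_y (x) y].
   The set of [y] occurring in the coaction is [gK], so it determines [K] and the
   degree of [W].  An isomorphism must have the form [b_x |-> lam(x) b'_x], and
   compatibility with the coactions reads
   [e(u) lam(xu) = lam(x) e'(u)].  Hence [lam(xu)/lam(x)] does not depend on [x]
   for [u] in the support of [e], therefore for all [u] in [K], and defines the
   character [nu].  Conversely, a character yields such a [lam]. *)
Require Import Defs.
From mathcomp Require Import all_boot all_order all_algebra all_fingroup pgroup.
From HB Require Import structures.
From mathcomp Require Import boolp.
Import GRing.Theory.

Set Implicit Arguments.
Unset Strict Implicit.
Unset Printing Implicit Defensive.

Local Open Scope ring_scope.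

Lemma scaler_injl (k : fieldType) (V : lmodType k) (v : V) :
  v != 0 -> injective (fun a : k => a *: v).
Proof.
move=> nv a b /eqP; rewrite -subr_eq0 -scalerBl scaler_eq0 (negbTE nv) orbF.
by rewrite subr_eq0 => /eqP.
Qed.

(** * Comodules as graded spaces, and graded lines *)

Section Comodules.
Variables (k : fieldType) (B : finType).

Lemma sweedler_tensor (V U : lmodType k) (t : tens V B) (F : V -> U) :
  sweedler t (fun v x => F v ⊗ x) = [ffun b => F (t b)].
Proof. by rewrite -sum_tensor_bas. Qed.

(** Coassociativity read at a single grouplike: the components of the coaction are homogeneous, so
    [W] is graded by [B]. *)
Lemma coact_coact (W : comodule k B) w b :
  comod_coact W (comod_coact W w b) = comod_coact W w b ⊗ bas k b.
Proof.
have := comod_coassoc w.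
rewrite (_ : sweedler _ _ = [ffun b => comod_coact W (comod_coact W w b)]).
  rewrite (_ : sweedler _ _ = [ffun b => comod_coact W w b ⊗ bas k b]).
    by move=> /ffunP/(_ b); rewrite !ffunE.
  rewrite -sum_tensor_bas; apply: eq_bigr => c _.
  by rewrite comul_bas // => a y z; rewrite tensorZr tensorZl.
rewrite -sum_tensor_bas; apply: eq_bigr => c _.
by rewrite [in RHS](tensor_sum (comod_coact W _)) tensor_suml.
Qed.

Lemma sum_coact (W : comodule k B) w : \sum_b comod_coact W w b = w.
Proof.
rewrite -[RHS](comod_counit w); apply: eq_bigr => b _.
by rewrite counit_bas scale1r.
Qed.

Definition spans_comodule (W : comodule k B) (b : B) (w : comod_space W) :=
  [/\ w != 0, comod_coact W w = w ⊗ bas k b & forall v, exists a, v = a *: w].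
Arguments spans_comodule : clear implicits.

(** Send [w] to [w']. The coordinate along [w] is obtained by choice; it is linear because [w != 0]
    makes it unique. *)
Lemma comod_isomorphic_line (W W' : comodule k B) b w w' :
  spans_comodule W b w -> spans_comodule W' b w' -> comod_isomorphic W W'.
Proof.
move=> [w0 wb wW] [w0' wb' wW'].
have [c cP] := choice wW; have [c' cP'] := choice wW'.
have lin : linear (fun v => c v *: w').
  move=> a u v; rewrite scalerA -scalerDl; congr (_ *: _).
  by apply: (scaler_injl w0) => //; rewrite -cP scalerDl -scalerA -!cP.
pose f : {linear comod_space W -> comod_space W'} :=
  HB.pack (fun v => c v *: w') (GRing.isLinear.Build _ _ _ _ _ lin).
exists f.
  exists (fun v => c' v *: w) => v /=.
    by rewrite [RHS]cP; congr (_ *: _); apply: (scaler_injl w0'); rewrite // -cP'.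
  by rewrite [RHS]cP'; congr (_ *: _); apply: (scaler_injl w0); rewrite // -cP.
move=> v; rewrite sweedler_tensor /= linearZ /= wb'.
apply/ffunP => d; rewrite [in LHS](cP v) linearZ wb !ffunE /=.
rewrite [RHS]scalerA; congr (_ *: _).
by apply: (scaler_injl w0) => //; rewrite -cP scalerA.
Qed.

Lemma spans_comodule_degree (W : comodule k B) b c w v :
  spans_comodule W b w -> comod_coact W v = v ⊗ bas k c -> v != 0 -> b = c.
Proof.
move=> [_ wb /(_ v)[a ->]]; rewrite linearZ /= wb => /ffunP/(_ b).
rewrite !ffunE eqxx scale1r => ->; case: (eqVneq c b) => // _.
by rewrite scale0r eqxx.
Qed.

End Comodules.

Arguments spans_comodule {k B} W b w.

(** * Invariants of partial comodules, and characters from scalar families *)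

Section Pcomodules.
Variables (k : fieldType) (G : finGroupType).

Lemma pcom_morphismP (M N : pcomodule k G)
    (f : {linear pcom_space M -> pcom_space N}) :
  pcom_morphism f <->
  forall m g, pcom_coact N (f m) g = f (pcom_coact M m g).
Proof.
split=> [fP m g|fP m]; first by rewrite -fP sweedler_tensor ffunE.
by rewrite sweedler_tensor; apply/ffunP => g; rewrite ffunE fP.
Qed.

Lemma pcom_iso_coact_neq0 (M N : pcomodule k G) g :
  pcom_isomorphic M N ->
  (exists m, pcom_coact M m g != 0) <-> (exists n, pcom_coact N n g != 0).
Proof.
move=> [f [f' fK f'K]] /pcom_morphismP fP; split=> [[m]|[n nz]].
  by exists (f m); rewrite fP raddf_eq0 //; apply: can_inj fK.
exists (f' n); move: nz; rewrite -{1}(f'K n) fP.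
by apply: contra => /eqP->; rewrite raddf0.
Qed.

Lemma char_twistE (K : {group G}) nu (x : kspan k G) g :
  char_twist K nu x g = if g \in K then x g * nu g else 0.
Proof.
rewrite sum_ffunE big_mkcond /= (bigD1 g) //= big1 ?addr0 => [|h /negbTE nh].
  by case: ifP => // _; rewrite !ffunE eqxx [_ *: _]mulr1.
by case: ifP => // _; rewrite !ffunE nh scaler0.
Qed.

(** For [u] in the support of [e], the ratio [mu (h * u) / mu h] equals [e' u / e u], independently
    of [h]. The elements with this independence form a subgroup, hence all of [K], and the ratio is
    the character. *)
Lemma supp_group_char (e e' : kspan k G) (mu : G -> k) :
    {in supp_group e, forall h, mu h != 0} ->
    {in supp_group e &, forall h u, e u * mu (h * u)%g = mu h * e' u} ->
  exists nu, mult_character (supp_group e) nu /\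
    {in supp_group e, forall u, e' u = e u * nu u}.
Proof.
set K := supp_group e => mu0 muE.
(* Independence of [h], with denominators cleared: the ratio at [h] equals the one at [1]. *)
pose A := [set u in K | [forall h in K, mu (h * u)%g * mu 1%g == mu h * mu u]].
have AP u h : u \in A -> h \in K -> mu (h * u)%g * mu 1%g = mu h * mu u.
  by rewrite inE => /andP[_ /forall_inP uA] /uA /eqP.
have AK u : u \in A -> u \in K by rewrite inE => /andP[].
have m1 : mu 1%g != 0 by apply: mu0.
have gA : group_set A.
  apply/group_setP; split=> [|u v uA vA].
    by rewrite inE group1; apply/forall_inP => h _; rewrite mulg1.
  have [uK vK] := (AK _ uA, AK _ vA).
  rewrite inE groupM //=; apply/forall_inP => h hK; apply/eqP/(mulIf m1).
  rewrite mulgA AP ?groupM // mulrAC AP // -!mulrA AP // [mu u * _]mulrC //.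
have KA : K \subset A.
  rewrite (gen_subG _ (group gA)); apply/subsetP => u; rewrite inE => eu.
  have uK : u \in K by apply: supp_groupP.
  (* After multiplication by [e u], both sides equal [mu h * e' u * mu 1], by [muE] at [h] and at
     [1]. *)
  rewrite inE uK; apply/forall_inP => h hK; apply/eqP/(mulfI eu).
  rewrite mulrA muE // -mulrA [RHS]mulrCA; congr (_ * _).
  by rewrite mulrC -muE ?group1 // mul1g.
exists (fun u => mu u / mu 1%g); split.
  split=> [u uK|u v uK vK]; first by rewrite unitfE mulf_neq0 ?invr_eq0 ?mu0.
  apply: (mulIf m1); rewrite divfK // -mulrA divfK //; apply: (mulIf m1).
  by rewrite AP ?(subsetP KA) // -mulrA [_ * mu 1%g]mulrC mulrA divfK.
move=> u uK; have := muE 1%g u (group1 _) uK; rewrite mul1g mulrA => ->.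
by rewrite mulrAC mulfV ?mul1r.
Qed.

End Pcomodules.

(** * Homogeneous elements of the cotensor product, and simplicity *)

Section CotensorElements.
Variables (k : fieldType) (G : finGroupType) (e : subcentral k G).
Variable (W : comodule k (cosets (supp_group e))).
Local Notation K := (supp_group e).
Local Notation rho := (@cotensor_coact k G e W).

Lemma subcentral_coef : exists2 u, u \in K & e u != 0.
Proof.
have [u eu|e0] := pickP (fun u => e u != 0).
  by exists u => //; apply: supp_groupP.
by have /eqP[] := sc_neq0 e; apply/ffunP => u; rewrite ffunE; apply/eqP/negbFE/e0.
Qed.

Lemma subcentral_coset g h : e (g^-1 * h)%g != 0 -> coset_pt K g = coset_pt K h.
Proof. by move=> /supp_groupP/coset_ptP. Qed.

Lemma coset_ptM g u : u \in K -> coset_pt K (g * u)%g = coset_pt K g.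
Proof. by move=> uK; apply/esym/coset_ptP; rewrite mulKg. Qed.

(** Idempotence of [e] gives the first condition. The second holds because [ge] is supported on
    [gK], where all degrees agree. *)
Lemma homogeneous_cotensor g w : comod_coact W w = w ⊗ bas k (coset_pt K g) ->
  w ⊗ gmul (bas k g) e \in cotensor_pred (W := W).
Proof.
move=> wg; apply/cotensorP; split=> h; rewrite tensorE.
  have {1}-> : gmul (bas k g) e = gmul (gmul (bas k g) e) e.
    by rewrite -gmulA sc_idem.
  rewrite gmulE scaler_suml; apply: eq_bigr => x _.
  by rewrite tensorE scalerA mulrC.
rewrite linearZ /= wg tensorZl gmul_basl.
have [e0|/subcentral_coset -> //] := eqVneq (e (g^-1 * h)%g) 0.
by rewrite (e0 : _ = 0 :> k) [LHS]scale0r [RHS]scale0r.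
Qed.

(* [w (x) ge], which lies in the cotensor product when [w] has degree [gK];
   the value is [0] otherwise. *)
Definition cot_elem g w : cotensor_space W :=
  insubd (0 : cotensor_space W) (w ⊗ gmul (bas k g) e).

Lemma cot_elemE g w x : comod_coact W w = w ⊗ bas k (coset_pt K g) ->
  cot_val (cot_elem g w) x = e (g^-1 * x)%g *: w.
Proof.
move=> /homogeneous_cotensor wg.
have -> : cot_val (cot_elem g w) = w ⊗ gmul (bas k g) e by exact: insubdK.
by rewrite tensorE gmul_basl.
Qed.

Lemma cot_elem_neq0 g w : comod_coact W w = w ⊗ bas k (coset_pt K g) ->
  w != 0 -> cot_elem g w != 0.
Proof.
move=> wg w0; have [u uK eu] := subcentral_coef; apply: contra_neq w0 => E.
have := cot_elemE (g * u)%g wg; rewrite E mulKg ffunE => /esym/eqP.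
by rewrite scaler_eq0 (negbTE eu) => /eqP.
Qed.

Lemma coact_cot_elem g w h : comod_coact W w = w ⊗ bas k (coset_pt K g) ->
  rho (cot_elem g w) h = (e (g^-1 * h)%g : k) *: cot_elem h w.
Proof.
move=> wg; apply: val_inj; apply/ffunP => x.
rewrite val_coact cot_elemE // [RHS]ffunE.
(* A nonzero coefficient puts [h] in [gK], so [w] has degree [hK] and [cot_elem h w] is not the
   default value. *)
have [->|egh] := eqVneq (e (g^-1 * h)%g) 0; first by rewrite !scale0r scaler0.
by rewrite cot_elemE -?(subcentral_coset egh) // !scalerA mulrC.
Qed.

(** The component at [g] is [t(g) (x) ge], and [ge] is nonzero. *)
Lemma coact_eq0 t g : (rho t g == 0) = (cot_val t g == 0).
Proof.
apply/eqP/eqP => [E|tg0].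
  have [u uK eu] := subcentral_coef.
  have := val_coact t g (g * u)%g; rewrite E mulKg ffunE => /esym/eqP.
  by rewrite scaler_eq0 (negbTE eu) => /eqP.
by apply: val_inj; apply/ffunP => x; rewrite val_coact tg0 scaler0 ffunE.
Qed.

Lemma coact_neq0_coset g w h : spans_comodule W (coset_pt K g) w ->
  (exists t, rho t h != 0) <-> coset_pt K g = coset_pt K h.
Proof.
move=> wW; have [w0 wg _] := wW; split=> [[t]|gh].
  rewrite coact_eq0; apply: spans_comodule_degree wW _.
  by case/cotensorP: (cot_valP t) => _.
have [u uK eu] := subcentral_coef.
have hu : coset_pt K (h * u^-1) = coset_pt K g by rewrite coset_ptM ?groupV.
(* The shift by [u^-1] makes the value at [h] equal to [e u *: w]. *)
exists (cot_elem (h * u^-1)%g w); rewrite coact_eq0 cot_elemE ?hu //.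
by rewrite invMg invgK mulgKV scaler_eq0 negb_or eu.
Qed.

(* If [t(g) = w] is nonzero, the elements of [M] with values in [k w] on [gK] and
   vanishing elsewhere form a partial subcomodule, which must be all of [M]. *)
Lemma simple_spans_comodule : pcom_simple (cotensor W) ->
  exists g w, spans_comodule W (coset_pt K g) w.
Proof.
move=> [[t t0] simple].
have [g tg0|tg0] := pickP (fun g => cot_val t g != 0); last first.
  case/eqP: t0; apply: val_inj; apply/ffunP => g; rewrite ffunE.
  exact/eqP/negbFE/tg0.
exists g, (cot_val t g); set w := cot_val t g in tg0 *.
have wg : comod_coact W w = w ⊗ bas k (coset_pt K g).
  by case/cotensorP: (cot_valP t) => _ /(_ g).
pose N : {pred pcom_space (cotensor W)} := [pred m : cotensor_space W |
  `[< forall h, exists2 a, cot_val m h = a *: w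
                         & coset_pt K g != coset_pt K h -> a = 0 >]].
have NP m : m \in N <-> forall h, exists2 a, cot_val m h = a *: w
                         & coset_pt K g != coset_pt K h -> a = 0.
  by split=> [/asboolP|?] //; apply/asboolP.
have subN : psubcomodule N.
  split; first split.
  - by apply/NP => h; exists 0; rewrite ?scale0r ?ffunE.
  - move=> a m n /NP mN /NP nN; apply/NP => h.
    have [[b mb b0] [c nc c0]] := (mN h, nN h).
    exists (a * b + c); last by move=> gh; rewrite b0 // c0 // mulr0 addr0.
    by rewrite !ffunE mb nc scalerDl scalerA.
  move=> m /NP mN h; apply/NP => x; have [a ma a0] := mN h.
  exists (e (h^-1 * x)%g * a); first by rewrite val_coact ma scalerA.
  have [->|/subcentral_coset <- /a0->] := eqVneq (e (h^-1 * x)%g) 0.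
    by rewrite mul0r.
  by rewrite mulr0.
have NT m : m \in N.
  (* [N] is not zero, since it contains the nonzero vector [cot_elem g w]. *)
  case: (simple N subN) => [N0|->//].
  have := cot_elem_neq0 wg tg0; rewrite -[_ == _]N0 => /negP[].
  apply/NP => h; exists (e (g^-1 * h)%g); first exact: cot_elemE.
  by move/eqP=> gh; apply/eqP; apply: contra_notT gh => /subcentral_coset.
split=> // v.
(* For [z] the component of [v] of degree [hK], the element [cot_elem h z] lies in [N] and has value
   [e u *: z] at [h * u]; dividing by [e u] puts [z] on the line of [w]. *)
have deg c : exists a, comod_coact W v c = a *: w.
  case: c => C CK; have /lcosetsP[h _ Ch] := CK.
  have -> : exist _ C CK = coset_pt K h by apply: val_inj.
  set z := comod_coact W v _; have [u uK eu] := subcentral_coef.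
  have /NP/(_ (h * u)%g)[a] := NT (cot_elem h z).
  rewrite cot_elemE ?coact_coact // mulKg => za _; exists ((e u)^-1 * a).
  by rewrite -scalerA -za scalerA mulVf ?scale1r.
have [a aP] := choice deg; exists (\sum_c a c).
by rewrite -[LHS]sum_coact scaler_suml; apply: eq_bigr.
Qed.

End CotensorElements.

(** * Transport of comodules along an equality of subgroups *)

Section CastComodule.
Variables (k : fieldType) (G : finGroupType) (K K' : {group G}).
Variables (eqK : K = K').
Variables (W : comodule k (cosets K)) (W' : comodule k (cosets K')).

Lemma cast_comodule_line g w w' :
    spans_comodule W (coset_pt K g) w -> spans_comodule W' (coset_pt K' g) w' ->
  comod_isomorphic (cast_comodule eqK W) W'.
Proof. by move: W' w'; case: _ / eqK => ? ?; apply: comod_isomorphic_line. Qed.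

(** Trades the transport along [eqK] for a linear bijection preserving and reflecting degrees, so
    that later arguments work with [W] itself. *)
Lemma cast_comodule_iso : comod_isomorphic (cast_comodule eqK W) W' ->
  exists2 f : {linear comod_space W -> comod_space W'}, bijective f &
    forall w g, comod_coact W w = w ⊗ bas k (coset_pt K g) <->
                comod_coact W' (f w) = f w ⊗ bas k (coset_pt K' g).
Proof.
move: W'; case: _ / eqK => W'' [f fbij fP]; exists f => // w g.
rewrite -fP sweedler_tensor; split=> [->|/ffunP E]; apply/ffunP => c.
  by rewrite !ffunE linearZ.
by apply: (bij_inj fbij); have := E c; rewrite !ffunE linearZ.
Qed.

End CastComodule.

(** * Rescaling maps between cotensor products *)

Section TwistMap.
Variables (k : fieldType) (G : finGroupType) (e e' : subcentral k G).
Variables (W : comodule k (cosets (supp_group e))).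
Variables (W' : comodule k (cosets (supp_group e'))).
Variables (f : {linear comod_space W -> comod_space W'}) (lam : G -> k).
Hypothesis lamE :
  forall g h, e' (h^-1 * g)%g * lam h = lam g * e (h^-1 * g)%g.
Hypothesis fdeg : forall w g,
  comod_coact W w = w ⊗ bas k (coset_pt (supp_group e) g) ->
  comod_coact W' (f w) = f w ⊗ bas k (coset_pt (supp_group e') g).

(** [lamE] turns the invariance of [t] under [e] into invariance under [e']; the same identity gives
    compatibility with the coactions in [twist_coact]. *)
Lemma twist_in_cotensor (t : cotensor_space W) :
  [ffun g => lam g *: f (cot_val t g)] \in cotensor_pred (W := W').
Proof.
have /cotensorP[te tW] := cot_valP t.
apply/cotensorP; split=> g; rewrite !ffunE.
  rewrite te linear_sum scaler_sumr; apply: eq_bigr => h _.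
  by rewrite ffunE linearZ !scalerA -lamE.
by rewrite linearZ /= (fdeg (tW g)) tensorZl.
Qed.

Definition twist t : cotensor_space W' := Cotensor (twist_in_cotensor t).

Lemma twist_linear : linear twist.
Proof.
move=> a u v; apply: val_inj; apply/ffunP => g; rewrite !ffunE /=.
by rewrite linearP scalerDr !scalerA mulrC.
Qed.

Lemma twist_coact t g : cotensor_coact (twist t) g = twist (cotensor_coact t g).
Proof.
apply: val_inj; apply/ffunP => h.
rewrite val_coact [RHS]ffunE val_coact [cot_val (twist t) g]ffunE.
by rewrite (linearZZ f) !scalerA lamE.
Qed.

End TwistMap.

(** * Isomorphisms of cotensor products *)

Section Isomorphisms.
Variables (k : fieldType) (G : finGroupType) (e e' : subcentral k G).
Variables (W : comodule k (cosets (supp_group e))).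
Variables (W' : comodule k (cosets (supp_group e'))).
Local Notation K := (supp_group e).
Local Notation K' := (supp_group e').

(** The inverse is again a twist, by the inverse of [f] and the pointwise inverse of [lam], with [e]
    and [e'] exchanged. *)
Lemma twist_cotensor_iso (f : {linear comod_space W -> comod_space W'})
    (lam : G -> k) :
    bijective f ->
    (forall w g, comod_coact W w = w ⊗ bas k (coset_pt K g) <->
                 comod_coact W' (f w) = f w ⊗ bas k (coset_pt K' g)) ->
    (forall g, lam g != 0) ->
    (forall g h, e' (h^-1 * g)%g * lam h = lam g * e (h^-1 * g)%g) ->
  pcom_isomorphic (cotensor W) (cotensor W').
Proof.
move=> [f' fK f'K] fdeg lam0 lamE.
pose f'l : {linear comod_space W' -> comod_space W} :=
  HB.pack f' (GRing.isLinear.Build _ _ _ _ _ (can2_linear fK f'K)).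
have lamVE g h : e (h^-1 * g)%g * (lam h)^-1 = (lam g)^-1 * e' (h^-1 * g)%g.
  apply: (mulfI (lam0 g)); rewrite mulrA -lamE mulVKf //.
  by rewrite -mulrA mulfV ?mulr1.
have f'deg w g : comod_coact W' w = w ⊗ bas k (coset_pt K' g) ->
    comod_coact W (f'l w) = f'l w ⊗ bas k (coset_pt K g).
  by move=> wg; apply/fdeg; rewrite /= f'K.
have fdeg1 w g := (fdeg w g).1.
pose T : {linear cotensor_space W -> cotensor_space W'} :=
  HB.pack (twist lamE fdeg1)
    (GRing.isLinear.Build _ _ _ _ _ (twist_linear lamE fdeg1)).
exists T; last by apply/pcom_morphismP => m g; apply: twist_coact.
have f'Z a v : f' (a *: v) = a *: f' v := linearZZ f'l a v.
exists (twist lamVE f'deg) => t; apply: val_inj; apply/ffunP => g.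
  rewrite !ffunE /= f'Z fK scalerA mulVf ?scale1r //.
by rewrite !ffunE /= (linearZZ f) f'K scalerA mulfV ?scale1r.
Qed.

Lemma char_twist_cotensor_iso (eqK : K = K') (nu : G -> k) :
    comod_isomorphic (cast_comodule eqK W) W' -> mult_character K nu ->
    char_twist K nu e = e' ->
  pcom_isomorphic (cotensor W) (cotensor W').
Proof.
move=> /cast_comodule_iso[f fbij fdeg] [nuU nuM] nue.
(* Extends [nu] to [G] through coset representatives, so that [lam (h * u) = lam h * nu u] for [u]
   in [K]. *)
pose lam g := nu ((repr (g *: K))^-1 * g)%g.
have reprK g : ((repr (g *: K))^-1 * g)%g \in K.
  have /lcosetP[u uK ->] := mem_repr g (lcoset_refl K g).
  by rewrite invMg mulgKV groupV.
apply: (@twist_cotensor_iso f lam) => // [g|g h].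
  by have := nuU _ (reprK g); rewrite unitfE.
rewrite -nue char_twistE; case: ifP => hg; last first.
  rewrite mul0r; case: (eqVneq (e (h^-1 * g)%g) 0) => [->|]; rewrite ?mulr0 //.
  by move/supp_groupP; rewrite hg.
rewrite -mulrA [RHS]mulrC; congr (_ * _); rewrite mulrC /lam.
(* [g] and [h] share a coset, hence a representative, and multiplicativity of [nu] applies. *)
have /coset_ptP/(congr1 val)/= <- := hg.
by rewrite -nuM // mulgA mulgK.
Qed.

(** The group elements occurring in the coaction form [gK] for one side and [g'K'] for the other. An
    isomorphism preserves this set, and translating it by the inverse of [g] recovers the
    subgroup. *)
Lemma cotensor_iso_coset g w g' w' :
    pcom_isomorphic (cotensor W) (cotensor W') ->
    spans_comodule W (coset_pt K g) w -> spans_comodule W' (coset_pt K' g') w' ->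
  K = K' /\ coset_pt K' g' = coset_pt K' g.
Proof.
move=> isoM wW wW'.
have H h : (g^-1 * h \in K)%g = (g'^-1 * h \in K')%g.
  apply/coset_ptP/coset_ptP => E.
    apply/(coact_neq0_coset _ wW')/(pcom_iso_coact_neq0 _ isoM).
    exact/(coact_neq0_coset _ wW).
  apply/(coact_neq0_coset _ wW)/(pcom_iso_coact_neq0 _ isoM).
  exact/(coact_neq0_coset _ wW').
have gg' : (g'^-1 * g \in K')%g by rewrite -H mulVg group1.
split; last exact/coset_ptP.
apply/val_inj/setP => u; have := H (g * u)%g.
by rewrite mulKg mulgA groupMl.
Qed.

Lemma cotensor_iso_char g w w' :
    K = K' -> pcom_isomorphic (cotensor W) (cotensor W') ->
    spans_comodule W (coset_pt K g) w -> spans_comodule W' (coset_pt K' g) w' ->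
  exists nu, mult_character K nu /\ char_twist K nu e = e'.
Proof.
move=> eqK [f fbij /pcom_morphismP fP] [w0 wg _] [w'0 wg' wW'].
have deg u : u \in K -> comod_coact W w = w ⊗ bas k (coset_pt K (g * u)%g).
  by move=> uK; rewrite coset_ptM.
have deg' u : u \in K -> comod_coact W' w' = w' ⊗ bas k (coset_pt K' (g * u)%g).
  by rewrite eqK => uK; rewrite coset_ptM.
pose b u : cotensor_space W := cot_elem (g * u)%g w.
pose b' u : cotensor_space W' := cot_elem (g * u)%g w'.
(* Compare the components at [g * (h * u)] of the coaction, before and after applying [f]. *)
have fb h u : h \in K ->
    (e u : k) *: f (b (h * u)%g)
    = cotensor_coact (f (b h) : cotensor_space W') (g * (h * u))%g.
  move=> hK; have := coact_cot_elem (g * (h * u))%g (deg _ hK).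
  rewrite mulgA mulKg -mulgA => bE.
  transitivity (f ((e u : k) *: b (h * u)%g)); first exact/esym/linearZZ.
  by rewrite -[X in f X]bE; apply: esym (fP _ _).
(* With [e v != 0] and [h = u * v^-1], [fb] writes [e v *: f (b u)] as a coaction component at
   [g * u]. Such a component is a vector of the line of [w'] tensored with [(gu)e'], hence a
   multiple of [b' u]. *)
have muP u : exists l : k, u \in K -> l != 0 /\ f (b u) = l *: b' u.
  case: (boolP (u \in K)) => uK; last by exists 0.
  have [v vK ev] := subcentral_coef e.
  have hK : (u * v^-1)%g \in K by rewrite groupM ?groupV.
  have := fb _ v hK; rewrite mulgKV => E.
  have [a aE] := wW' (cot_val (f (b (u * v^-1)%g)) (g * u)%g).
  have fE : f (b u) = (((e v)^-1 * a : k) *: b' u).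
    rewrite -scalerA; apply: (canRL (scalerK ev)); rewrite E.
    apply: val_inj; apply/ffunP => x; rewrite val_coact aE ffunE.
    by rewrite (cot_elemE _ (deg' _ uK)) !scalerA mulrC.
  exists ((e v)^-1 * a) => _; split=> //.
  apply: contra_neq (cot_elem_neq0 (deg _ uK) w0) => l0.
  by apply: (bij_inj fbij); rewrite linear0 [LHS]fE l0 scale0r.
have [mu {}muP] := choice muP.
have [|h u hK uK|nu [nuP nuE]] := @supp_group_char _ _ e e' mu.
- by move=> h /muP[].
(* Substituting [f (b h) = mu h *: b' h] in [fb] and comparing coefficients of [b' (h * u)] gives
   the relation between [e] and [e']. *)
- have huK := groupM hK uK.
  have b'0 : b' (h * u)%g != 0 by exact: cot_elem_neq0 (deg' _ huK) w'0.
  apply: (scaler_injl b'0); have := fb h u hK.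
  rewrite (muP _ hK).2 (muP _ huK).2 scalerA => ->.
  have := coact_cot_elem (g * (h * u))%g (deg' _ hK).
  rewrite mulgA mulKg -mulgA => b'E.
  by rewrite linearZ ffunE [X in _ *: X = _]b'E scalerA.
exists nu; split=> //; apply/ffunP => u; rewrite char_twistE.
case: ifP => [/nuE->//|]; rewrite eqK => uK.
by apply/esym/eqP; apply: contraFT uK; apply: supp_groupP.
Qed.

End Isomorphisms.

Theorem theorem4p5 (k : fieldType) (G : finGroupType)
    (char_ndiv : ([pchar k]%R^'.-group [set: G])%g)
    (e e' : subcentral k G)
    (W : comodule k (cosets (supp_group e)))
    (W' : comodule k (cosets (supp_group e')))
    (simpleM : pcom_simple (cotensor W))
    (simpleM' : pcom_simple (cotensor W')) :
  pcom_isomorphic (cotensor W) (cotensor W') <->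
  (exists eqK : supp_group e = supp_group e',
     comod_isomorphic (cast_comodule eqK W) W') /\
  (exists nu : G -> k,
     mult_character (supp_group e) nu /\
     char_twist (supp_group e) nu e = e').
Proof.
split=> [isoM|[[eqK isoW] [nu [nuP nue]]]]; last first.
  exact: char_twist_cotensor_iso isoW nuP nue.
have [g [w wW]] := simple_spans_comodule simpleM.
have [g' [w' wW']] := simple_spans_comodule simpleM'.
(* From here both lines have their degree given by the same [g]. *)
have [eqK gg'] := cotensor_iso_coset isoM wW wW'; rewrite {}gg' in wW'.
split; last exact: cotensor_iso_char isoM wW wW'.
exists eqK; exact: cast_comodule_line wW wW'.
Qed.
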